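(* Let $Z:\mathfrak{H}^0\to\mathcal{Z}^{\mathcal{C}}$ be the $\mathbb{Q}$-linear map determined by $Z(1)=1$ and $$Z(yx^{k_1-1}yx^{k_2-1}\cdots yx^{k_r-1})=\zeta^{\mathcal{C}}(k_1,k_2,\ldots,k_r)$$ for all $r\geq 1$ and integers $k_1,\ldots,k_{r-1}\geq 1$, $k_r\geq 2$. Then $Z$ is an algebra homomorphism with respect to the shuffle product on $\mathfrak{H}^0$; that is, $Z(w_1\,ш\,w_2)=Z(w_1)\,Z(w_2)$ for all $w_1,w_2\in\mathfrak{H}^0$, where $ш$ denotes the shuffle product.
   Context: For $r\geq 1$ and integers $k_1,\ldots,k_{r-1}\geq 1$, $k_r\geq 2$, the continuous multiple zeta value is the (convergent) real number $$\zeta^{\mathcal{C}}(k_1,\ldots,k_r)=\int\cdots\int_{[1,+\infty)^r}\frac{dx_1\cdots dx_r}{x_1^{k_1}(x_1+x_2)^{k_2}\cdots(x_1+\cdots+x_r)^{k_r}}.$$ $\mathcal{Z}^{\mathcal{C}}\subseteq\mathbb{R}$ is the $\mathbb{Q}$-linear space generated by $1$ and all continuous multiple zeta values; products of its elements are taken in $\mathbb{R}$. $\mathfrak{H}=\mathbb{Q}\langle x,y\rangle$ is the non-commutative polynomial ring over $\mathbb{Q}$ in two indeterminates $x,y$. The shuffle product $ш$ on $\mathfrak{H}$ is the $\mathbb{Q}$-bilinear product defined inductively on words by $1\,ш\,w=w\,ш\,1=w$ and $$uw_1\,ш\,vw_2=u(w_1\,ш\,vw_2)+v(uw_1\,ш\,w_2)$$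 for $u,v\in\{x,y\}$ and words $w,w_1,w_2$. Under $ш$, $\mathfrak{H}$ is a commutative $\mathbb{Q}$-algebra, and $\mathfrak{H}^0=\mathbb{Q}+y\mathfrak{H}x$ is a $\mathbb{Q}$-subalgebra of it. The words $yx^{k_1-1}\cdots yx^{k_r-1}$ with $k_1,\ldots,k_{r-1}\ge1$, $k_r\ge2$, together with $1$, form a $\mathbb{Q}$-basis of $\mathfrak{H}^0$. *)

(* Defs.v *)
From HB Require Import structures.
From mathcomp Require Import all_boot all_order all_algebra finmap.
From mathcomp.multinomials Require Import monalg.
From mathcomp Require Import all_classical all_reals all_analysis.

Set Implicit Arguments.
Unset Strict Implicit.
Unset Printing Implicit Defensive.
Import Order.TTheory GRing.Theory Num.Theory.
Local Open Scope classical_set_scope.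
Local Open Scope ring_scope.

Section LebesgueTuple.
Variable R : realType.
Local Notation mR := (measurableTypeR R).

Definition consT n (p : mR * n.-tuple mR) : n.+1.-tuple mR :=
  [the n.+1.-tuple mR of p.1 :: p.2].

Lemma measurable_consT n : measurable_fun [set: mR * n.-tuple mR] (@consT n).
Proof. by apply: measurable_cons. Qed.

Section Step.
Variables (n : nat) (mu : {sigma_finite_measure set (n.-tuple mR) -> \bar R}).

(* The image of the product measure on R x R^n under (x, t) |-> x :: t. *)
Definition lebesgue_cons : set (n.+1.-tuple mR) -> \bar R :=
  pushforward (@lebesgue_measure R \x mu)%E (@consT n).

Let measurable_preim A : measurable A -> measurable (@consT n @^-1` A).
Proof. by move=> mA; rewrite -[X in measurable X]setTI; exact: measurable_consT. Qed.

Let lebesgue_cons0 : lebesgue_cons set0 = 0%E.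
Proof. by rewrite /lebesgue_cons /pushforward preimage_set0 measure0. Qed.

Let lebesgue_cons_ge0 A : (0 <= lebesgue_cons A)%E.
Proof. by rewrite /lebesgue_cons /pushforward; apply: measure_ge0. Qed.

Let lebesgue_cons_sigma_additive : semi_sigma_additive lebesgue_cons.
Proof.
move=> F mF tF mUF; rewrite /lebesgue_cons /pushforward preimage_bigcup.
apply: measure_semi_sigma_additive => [i||].
- exact: measurable_preim.
- apply/trivIsetP => /= i j _ _ ij; rewrite -preimage_setI.
  by move/trivIsetP : tF => /(_ _ _ _ _ ij) ->//; rewrite preimage_set0.
- by rewrite -preimage_bigcup; exact: measurable_preim.
Qed.

HB.instance Definition _ := isMeasure.Build _ _ _ lebesgue_cons
  lebesgue_cons0 lebesgue_cons_ge0 lebesgue_cons_sigma_additive.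

Let lebesgue_cons_sigma_finite : sigma_finite setT lebesgue_cons.
Proof.
have [F FT Ffin] : sigma_finite setT (@lebesgue_measure R \x mu)%E.
  have /sigma_finiteP[F [TF ndF Foo]] := sigma_finiteT (@lebesgue_measure R).
  have /sigma_finiteP[G [TG ndG Goo]] := sigma_finiteT mu.
  exists (fun i => F i `*` G i).
    rewrite -setXTT TF TG predeqE => -[x y]; split.
      move=> [/= [i _ Fix] [k _ Gky]]; exists (maxn i k) => //; split.
      - by move: x Fix; exact/subsetPset/ndF/leq_maxl.
      - by move: y Gky; exact/subsetPset/ndG/leq_maxr.
    by move=> [i _ []/= ? ?]; split; exists i.
  move=> k; have [? ?] := Foo k; have [? ?] := Goo k.
  split; first exact: measurableX.
  by rewrite product_measure1E// lte_mul_pinfty// ge0_fin_numE.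
pose unconsT (t : n.+1.-tuple mR) : mR * n.-tuple mR :=
  (thead t, [tuple of behead t]).
have consK : cancel (@consT n) unconsT.
  by move=> [x t]; congr (_, _); apply: val_inj.
have unconsK : cancel unconsT (@consT n).
  by move=> t; rewrite [RHS]tuple_eta; apply: val_inj.
have munconsT : measurable_fun setT unconsT.
  apply/measurable_fun_pairP; split; first exact: measurable_tnth.
  exact: measurable_behead.
exists (fun i => unconsT @^-1` F i); first by rewrite -preimage_bigcup -FT.
move=> i; have [mF Foo] := Ffin i; split.
  by rewrite -[X in measurable X]setTI; exact: munconsT.
rewrite /lebesgue_cons /pushforward -comp_preimage.
by rewrite (_ : unconsT \o _ = id) ?preimage_id//; apply/funext => p /=; exact: consK.
Qed.

HB.instance Definition _ := Measure_isSigmaFinite.Build _ _ _ lebesgue_cons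
  lebesgue_cons_sigma_finite.
End Step.

(* The library has the product of two sigma-finite measures only;
   lebesgue_tuple n is the n-fold product, on R^n = n.-tuple R. *)
Fixpoint lebesgue_tuple n : {sigma_finite_measure set (n.-tuple mR) -> \bar R} :=
  if n is n'.+1 then lebesgue_cons (lebesgue_tuple n')
  else (\d_ ([tuple] : 0.-tuple mR)).

Lemma lebesgue_tuple_box n (A : 'I_n -> set mR) :
  (forall i, measurable (A i)) ->
  lebesgue_tuple n [set t | forall i, A i (tnth t i)] =
  (\prod_(i < n) lebesgue_measure (A i))%E.
Proof.
elim: n A => [|n IH] A mA.
  rewrite big_ord0 /= diracE (_ : _ \in _ = true)//.
  by apply/mem_set => -[].
rewrite big_ord_recl -IH; last by move=> i; exact: mA.
rewrite -product_measure1E//; last first.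
  rewrite (_ : mkset _ = \bigcap_(i in [set: 'I_n])
      (@tnth _ mR ^~ i) @^-1` A (lift ord0 i)); last first.
    by apply/seteqP; split=> t /= tA i => [_|]; apply: tA.
  apply: fin_bigcap_measurable => [|i _]; first exact: finite_finset.
  by rewrite -[X in measurable X]setTI; exact: measurable_tnth.
rewrite /= /lebesgue_cons /pushforward; congr (_ _).
apply/seteqP; split=> -[x t] /= H.
  by split=> [|i]; [exact: (H ord0) | have := H (lift ord0 i); rewrite tnthS].
by move=> i; case: (unliftP ord0 i) => [j ->|->]; [rewrite tnthS; exact: H.2|exact: H.1].
Qed.

End LebesgueTuple.

(* lists [:: k_1; ...; k_r] with r >= 1, k_1, ..., k_(r-1) >= 1 and k_r >= 2 *)
Definition admissible (ks : seq nat) : bool :=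
  [&& (0 < size ks)%N, all (leq 1) ks & (1 < last 0%N ks)%N].

(* tnth x j is x_(j+1), and the condition j <= i makes the i-th factor
   (x_1 + ... + x_(i+1)) ^ k_(i+1). The integrand is nonnegative; the real-valued
   integral would be 0 if the integral were infinite, which does not happen for
   admissible ks. *)
Definition zetaC (R : realType) (ks : seq nat) : R :=
  \int[lebesgue_tuple R (size ks)]_(x in [set x | forall i, 1 <= (tnth x i : R)])
    (\prod_(i < size ks)
       (\sum_(j < size ks | (j <= i)%N) (tnth x j : R)) ^+ nth 0%N ks i)^-1.

(* the Q-span of 1 and of the zetaC R ks, ks admissible; R carries no lmodType rat structure *)
Definition spanZC (R : realType) : set R :=
  [set z | exists (c : rat) (s : seq (rat * seq nat)),
     all (fun p => admissible p.2) s /\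
     z = ratr c + \sum_(p <- s) ratr p.1 * zetaC R p.2].

(* Q<x, y>, with letters x = false and y = true *)
Notation Hxy := {malg rat[{fmonom bool}]}.

Definition word (s : seq bool) : Hxy := << FMonom s >>.
Notation varx := (word [:: false]).
Notation vary := (word [:: true]).

Fixpoint shuffle_word (u : seq bool) : seq bool -> Hxy :=
  fix shuffle_u (v : seq bool) : Hxy :=
  match u, v with
  | [::], _ => word v
  | _, [::] => word u
  | a :: u', b :: v' =>
      word [:: a] * shuffle_word u' v + word [:: b] * shuffle_u v'
  end.

Definition shuffle (f g : Hxy) : Hxy :=
  \sum_(u <- msupp f) \sum_(v <- msupp g) (f@_u * g@_v) *: shuffle_word u v.

Definition in_H0 : {pred Hxy} :=
  fun f => `[< exists (c : rat) (h : Hxy), f = c%:A + vary * h * varx >].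

Lemma monomM (a b : rat) s t :
  << a *g FMonom s >> * << b *g FMonom t >> =
  << a * b *g FMonom (s ++ t) >> :> Hxy.
Proof.
by rewrite [LHS]fgmulUU; congr mkmalgU; exact: fmmulE.
Qed.

Lemma word_cat s t : word (s ++ t) = word s * word t.
Proof. by rewrite [RHS]monomM mulr1. Qed.

Lemma in_H0P (f : Hxy) : reflect (exists c h, f = c%:A + vary * h * varx) (f \in in_H0).
Proof. exact: asboolP. Qed.

Definition word0 (s : seq bool) :=
  (s == [::]) || (ohead s == Some true) && ~~ last true s.

Lemma word0P s :
  reflect (s = [::] \/ exists t, s = true :: rcons t false) (word0 s).
Proof.
apply: (iffP idP) => [|[->//|[t ->]]]; last by rewrite /word0 /= last_rcons.
case: s => [|[] s]; [by left| |by rewrite /word0].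
by rewrite /word0 /=; case: (lastP s) => // t [|]; rewrite last_rcons //; right; exists t.
Qed.

Lemma in_H0_suppP (f : Hxy) :
  reflect (forall m, m \in msupp f -> word0 m) (f \in in_H0).
Proof.
apply: (iffP (in_H0P f)) => [[c [h ->]] m|Hf].
  move=> /(fsubsetP (msuppD_le _ _)); rewrite in_fsetU => /orP[].
    move=> /(fsubsetP (msuppZ_le _ _)); rewrite msuppU1 in_fset1 => /eqP->.
    by rewrite /word0 fm1.
  move=> /msuppM_le[m1 [m2 [/msuppM_le[m3 [m4 [+ _ ->]]] + ->]]].
  rewrite !msuppU1 !in_fset1 => /eqP-> /eqP->; apply/word0P; right.
  by exists m4; rewrite !fmM /= cats1.
rewrite [f]monalgE big_seq; elim/big_rec : _ => [|k g kf [c [h ->]]].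
  by exists 0, 0; rewrite mulr0 mul0r scale0r addr0.
case/word0P: (Hf k kf) => [k0|[t kt]].
  have fk : << f@_k *g k >> = (f@_k)%:A :> Hxy.
    rewrite -mul_malgC mulr1; congr mkmalgU.
    by apply: val_inj; rewrite /= k0 fm1.
  by exists (f@_k + c), h; rewrite fk scalerDl addrA.
have fk : << f@_k *g k >> = vary * << f@_k *g FMonom t >> * varx :> Hxy.
  rewrite [vary * _]monomM [RHS]monomM mul1r mulr1; congr mkmalgU.
  by apply: val_inj; rewrite /= kt cats1.
exists c, (<< f@_k *g FMonom t >> + h).
by rewrite addrCA mulrDr mulrDl fk.
Qed.

Lemma in_H0_submod : submod_closed in_H0.
Proof.
split; first by apply/in_H0_suppP => m; rewrite msupp0.
move=> a f g /in_H0_suppP Hf /in_H0_suppP Hg; apply/in_H0_suppP => m.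
move=> /(fsubsetP (msuppD_le _ _)); rewrite in_fsetU => /orP[|/Hg//].
by move=> /(fsubsetP (msuppZ_le _ _)) /Hf.
Qed.
HB.instance Definition _ := GRing.isSubmodClosed.Build _ _ in_H0 in_H0_submod.

Record H0 := MkH0 { H0val :> Hxy; _ : H0val \in in_H0 }.
HB.instance Definition _ := [isSub for H0val].
HB.instance Definition _ := [Choice of H0 by <:].
HB.instance Definition _ := [SubChoice_isSubLmodule of H0 by <:].

Lemma shuffle_word0 s : shuffle_word [::] s = word s.
Proof. by case: s. Qed.

Lemma shuffle_words0 s : shuffle_word s [::] = word s.
Proof. by case: s. Qed.

Lemma shuffle_word_cons a u b v :
  shuffle_word (a :: u) (b :: v) =
  word [:: a] * shuffle_word u (b :: v) + word [:: b] * shuffle_word (a :: u) v.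
Proof. by []. Qed.

Lemma mulr_sum2 (A : pzRingType) (a b h h' x : A) :
  a * (h * x) + b * (h' * x) = (a * h + b * h') * x.
Proof. by rewrite mulrDl !mulrA. Qed.

Lemma shuffle_word_rcons u v :
  exists h, shuffle_word (rcons u false) (rcons v false) = h * varx.
Proof.
elim: u v => [|a u IHu]; elim=> [|b v IHv]; rewrite ?rcons_cons.
- by exists (varx + varx); rewrite mulrDl.
- have [h hE] := IHv; exists (word (false :: b :: v) + word [:: b] * h).
  rewrite [LHS]shuffle_word_cons shuffle_word0 -word_cat mulrDl -mulrA -hE.
  by rewrite -word_cat cats1.
- have [h hE] := IHu [::]; exists (word [:: a] * h + word (false :: a :: u)).
  rewrite [LHS]shuffle_word_cons shuffle_words0 -word_cat mulrDl -mulrA -hE.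
  by rewrite -word_cat cats1.
- have [h hE] := IHu (b :: v); have [h' hE'] := IHv.
  exists (word [:: a] * h + word [:: b] * h').
  rewrite [LHS]shuffle_word_cons hE hE'; exact: mulr_sum2.
Qed.

Lemma in_H0_word s : word0 s -> word s \in in_H0.
Proof.
by move=> s0; apply/in_H0_suppP => m; rewrite msuppU1 in_fset1 => /eqP->.
Qed.

Lemma shuffle_word_H0 u v : word0 u -> word0 v -> shuffle_word u v \in in_H0.
Proof.
move=> /word0P[->|[s ->]] /word0P[->|[t ->]];
  rewrite ?shuffle_word0 ?shuffle_words0 //; try apply: in_H0_word => //.
- by apply/word0P; right; exists t.
- by apply/word0P; right; exists s.
have [h hE] := shuffle_word_rcons s (true :: t).
have [h' hE'] := shuffle_word_rcons (true :: s) t.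
apply/in_H0P; exists 0, (h + h').
rewrite [LHS]shuffle_word_cons -!rcons_cons hE hE' scale0r add0r mulrDr.
exact: mulr_sum2.
Qed.

Lemma shuffle_H0_closed (f g : H0) : shuffle f g \in in_H0.
Proof.
case: f g => [f /in_H0_suppP Hf] [g /in_H0_suppP Hg] /=.
rewrite /shuffle big_seq; apply: rpred_sum => u uf.
rewrite big_seq; apply: rpred_sum => v vg.
by apply: rpredZ; apply: shuffle_word_H0; [apply: Hf|apply: Hg].
Qed.

Definition shuffleH0 (f g : H0) : H0 := MkH0 (shuffle_H0_closed f g).

Lemma one_H0 : (1 : Hxy) \in in_H0.
Proof. by apply/in_H0P; exists 1, 0; rewrite mulr0 mul0r addr0 scale1r. Qed.

Definition oneH0 : H0 := MkH0 one_H0.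

Definition zword (ks : seq nat) : Hxy := \prod_(k <- ks) (vary * varx ^+ k.-1).

Definition zseq (ks : seq nat) : seq bool :=
  flatten [seq true :: nseq k.-1 false | k <- ks].

Lemma word_nil : word [::] = 1.
Proof. by rewrite /word; congr mkmalgU; rewrite -fmoneE. Qed.

Lemma varx_exp n : varx ^+ n = word (nseq n false).
Proof.
elim: n => [|n IHn]; first by rewrite expr0 word_nil.
by rewrite exprS IHn -word_cat.
Qed.

Lemma zwordE ks : zword ks = word (zseq ks).
Proof.
rewrite /zword; elim: ks => [|k ks IH]; first by rewrite big_nil word_nil.
have -> : zseq (k :: ks) = [:: true] ++ nseq k.-1 false ++ zseq ks by [].
rewrite big_cons IH !word_cat mulrA.
by rewrite varx_exp.
Qed.

Lemma zword_H0 ks : admissible ks -> zword ks \in in_H0.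
Proof.
move=> /and3P[]; rewrite zwordE; case/lastP: ks => // ks k _ _.
rewrite last_rcons => k1; apply: in_H0_word; rewrite /zseq map_rcons flatten_rcons.
apply/orP; right; apply/andP; split; first by case: ks.
by rewrite last_cat /=; case: k k1 => [|[|k]] // _ /=; elim: k.
Qed.

Definition zwordH0 ks (ks_adm : admissible ks) : H0 := MkH0 (zword_H0 ks_adm).

(* The words y x^(k_1 - 1) ... y x^(k_r - 1) are distinct monomials, so a linear
   map with the prescribed values exists. *)
Lemma exists_zeta_map (R : realType) :
  exists Z : {linear H0 -> R | ratr \; *%R}, Z oneH0 = 1 /\
    forall ks (ks_adm : admissible ks), Z (zwordH0 ks_adm) = zetaC R ks.
Proof.
pose dec := foldr (fun (b : bool) (p : nat * seq nat) =>
  if b then (0%N, p.1.+1 :: p.2) else (p.1.+1, p.2)) (0%N, [::]).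
have decE ks : all (leq 1) ks -> dec (zseq ks) = (0%N, ks).
  elim: ks => // k ks IH /= /andP[k0 /IH {}IH].
  suff -> : dec (nseq k.-1 false ++ zseq ks) = (k.-1, ks) by rewrite prednK.
  by elim: (k.-1) => //= n ->.
pose val_ (m : {fmonom bool}) : R :=
  if nilp m then 1 else zetaC R (dec m).2.
pose Z0 (f : H0) : R := mmap ratr val_ (H0val f).
have Z0D : nmod_morphism Z0.
  by split=> [|f g]; [exact: mmap0|exact: mmapD].
have Z0Z : scalable_for (ratr \; *%R) Z0.
  move=> a f; rewrite /Z0 (_ : H0val (a *: f) = a *: H0val f)//.
  rewrite (mmapEw (msuppZ_le _ _)) mmapE /= mulr_sumr.
  by apply: eq_bigr => k _; rewrite mcoeffZ rmorphM /= -mulrA.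
have Z0E s f : H0val f = word s -> Z0 f = val_ (FMonom s).
  by rewrite /Z0 => ->; rewrite mmapU -[RHS]mul1r; congr (_ * _); exact: rmorph1.
pose Zl : {linear H0 -> R | ratr \; *%R} := HB.pack Z0
  (GRing.isNmodMorphism.Build _ _ Z0 Z0D) (GRing.isScalable.Build _ _ _ _ Z0 Z0Z).
exists Zl; split=> [|ks ks_adm].
  by rewrite -[LHS]/(Z0 oneH0) (@Z0E [::]) //= word_nil.
rewrite -[LHS]/(Z0 (zwordH0 ks_adm)) (Z0E (zseq ks)); last exact: zwordE.
have /and3P[ks0 ks1 _] := ks_adm.
by rewrite /val_ /= decE //; case: (ks) ks0.
Qed.

(* Main.v *)
(* Give the letters of a word the measures [exp(-u)/u du] (for [y]) and [du]
   (for [x]) on the positive half-line, and let [word_int w t] be the iterated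
   integral of [w = a_1 ... a_n] over [t > u_1 > ... > u_n > 0].  By Tonelli,
   splitting a square along its diagonal, iterated integrals multiply by
   shuffling words.  They represent the continuous multiple zeta values because
   [exp(-(s+1)u)/u] is the integral of [exp(-(s+x)u)] over [x >= 1]: on Laplace
   transforms of [word_int w], prefixing [x] to [w] divides by [s], and
   prefixing [y] integrates over the shifts [s + x], [x >= 1] (up to a factor
   [1/s]), which is the recursion satisfied by the integrals defining [zetaC].  Everything is a
   nonnegative extended real, so that only the values at admissible words have
   to be shown finite; this follows from [k_r >= 2] by integrating the last
   variable first. *)
Require Import Defs.
From mathcomp Require Import all_boot all_order all_algebra finmap.
From mathcomp.multinomials Require Import monalg.
From mathcomp Require Import all_classical all_reals all_analysis.
From mathcomp Require Import measurable_realfun.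
Import Order.TTheory GRing.Theory Num.Theory.
Import numFieldNormedType.Exports.
Local Open Scope classical_set_scope.
Local Open Scope ring_scope.
Set Implicit Arguments.
Unset Strict Implicit.
Unset Printing Implicit Defensive.

(** * Measurability of inverses and of indicators *)

(** Writing [1/y] as [y * (y^2)^(-1)] reduces to a real power of a nonnegative base, which is
    measurable; at [y = 0] both sides are [0]. *)
Lemma measurable_funV d (T : measurableType d) (R : realType) (D : set T)
  (f : T -> R) : measurable_fun D f -> measurable_fun D (fun x => (f x)^-1).
Proof.
move=> mf; rewrite (_ : (fun x => (f x)^-1) = fun x => f x * powR (f x ^+ 2) (-1)).
  apply: measurable_funM => //.
  exact: (measurableT_comp (@measurable_powR R (-1)) (measurable_funX 2 mf)).
apply/funext => x; rewrite powR_inv1 ?sqr_ge0//.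
have [->|fx0] := eqVneq (f x) 0; first by rewrite invr0 mul0r.
by rewrite expr2 invfM mulrA divff// mul1r.
Qed.

Lemma measurable_fun_natr d (T : measurableType d) (R : realType)
  (b : T -> bool) : measurable_fun setT b -> measurable_fun setT (fun x => (b x)%:R : R).
Proof.
move=> mb; rewrite (_ : (fun x => _) = fun x => if b x then 1 else 0 : R).
  by apply: measurable_fun_ifT => //; exact: measurable_cst.
by apply/funext => x; case: (b x).
Qed.

(** * Integrals up to a variable bound and their products *)

Section iterated_integrals.
Variable R : realType.
Implicit Types (f g : R -> \bar R) (w : seq bool).
Local Notation mu := (@lebesgue_measure R).
Local Open Scope ereal_scope.

(* Indicators, so that all integrals below are over the whole line and
   Tonelli's theorem applies without restricting domains. *)
Definition ltind (u : R) (t : \bar R) : \bar R := ((u%:E < t)%E%:R)%:E.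
Definition leind (u t : R) : \bar R := ((u <= t)%R%:R)%:E.

Lemma ltind_ge0 u t : 0 <= ltind u t. Proof. by rewrite lee_fin. Qed.
Lemma leind_ge0 u t : 0 <= leind u t. Proof. by rewrite lee_fin. Qed.

Lemma measurable_ltind d (T : measurableType d) (h k : T -> R) :
  measurable_fun setT h -> measurable_fun setT k ->
  measurable_fun setT (fun x => ltind (h x) (k x)%:E).
Proof.
move=> mh mk; apply/measurable_EFinP/measurable_fun_natr.
under eq_fun do rewrite lte_fin.
exact: measurable_fun_ltr.
Qed.

Lemma measurable_ltindr t : measurable_fun setT (ltind^~ t).
Proof.
case: t => [t||]; first exact: measurable_ltind.
  rewrite (_ : ltind^~ _ = cst 1)//.
  by apply/funext => x; rewrite /ltind ltry.
by rewrite (_ : ltind^~ _ = cst 0).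
Qed.

Lemma measurable_leind d (T : measurableType d) (h k : T -> R) :
  measurable_fun setT h -> measurable_fun setT k ->
  measurable_fun setT (fun x => leind (h x) (k x)).
Proof.
by move=> mh mk; apply/measurable_EFinP/measurable_fun_natr/measurable_fun_ler.
Qed.

Lemma tonelli (h : R -> R -> \bar R) :
  measurable_fun setT (fun p : R * R => h p.1 p.2) -> (forall x y, 0 <= h x y) ->
  \int[mu]_x \int[mu]_y h x y = \int[mu]_y \int[mu]_x h x y.
Proof.
move=> mh h0.
by apply: (@fubini_tonelli _ _ _ _ _ mu mu (fun p : R * R => h p.1 p.2)) => // -[].
Qed.

(** The bound is extended real: finite bounds occur inside iterated integrals, and [+oo] gives the
    total integral. *)
Definition cum f (t : \bar R) := \int[mu]_u (f u * ltind u t).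

Lemma cum_ge0 f t : (forall u, 0 <= f u) -> 0 <= cum f t.
Proof. by move=> f0; apply: integral_ge0 => u _; rewrite mule_ge0// ltind_ge0. Qed.

Lemma measurable_cum f : measurable_fun setT f -> (forall u, 0 <= f u) ->
  measurable_fun setT (fun t => cum f t%:E).
Proof.
move=> mf f0.
apply: (measurable_fun_fubini_tonelli_F (m2 := mu)
  (fun p : R * R => f p.2 * ltind p.2 p.1%:E)) => [|p].
  by apply: emeasurable_funM; [exact: measurableT_comp|exact: measurable_ltind].
by rewrite mule_ge0// ltind_ge0.
Qed.

(** The two integrands differ at the single point [s], a null set. Cutting a square along its
    diagonal leaves a strict bound on one side and a weak one on the other; this makes them
    alike. *)
Lemma cum_leind f s : measurable_fun setT f ->
  \int[mu]_u (f u * leind u s) = cum f s%:E.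
Proof.
move=> mf; rewrite /cum.
have mD : measurable ([set: R] `\ s) by apply: measurableD.
rewrite -[LHS](@integral_setD1 _ _ s)//; last first.
  apply: (@measurable_funS _ _ _ _ setT) => //.
  by apply: emeasurable_funM => //; exact: measurable_leind.
rewrite -[RHS](@integral_setD1 _ _ s)//; last first.
  apply: (@measurable_funS _ _ _ _ setT) => //.
  by apply: emeasurable_funM => //; exact: measurable_ltindr.
apply: eq_integral => u; rewrite inE => -[_ /= /eqP us].
by rewrite /leind /ltind lte_fin lt_neqAle us.
Qed.

(* Splits the square [(-oo, t)^2] along its diagonal. *)
Lemma cumM f g t : measurable_fun setT f -> measurable_fun setT g ->
  (forall u, 0 <= f u) -> (forall u, 0 <= g u) ->
  cum f t * cum g t =
  cum (fun s => f s * cum g s%:E) t + cum (fun s => g s * cum f s%:E) t.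
Proof.
move=> mf mg f0 g0.
have mft : measurable_fun setT (fun s => f s * ltind s t).
  by apply: emeasurable_funM => //; exact: measurable_ltindr.
have mgt : measurable_fun setT (fun s => g s * ltind s t).
  by apply: emeasurable_funM => //; exact: measurable_ltindr.
have ft0 s : 0 <= f s * ltind s t by rewrite mule_ge0// ltind_ge0.
have gt0 s : 0 <= g s * ltind s t by rewrite mule_ge0// ltind_ge0.
(* [h1] lives on [u < s < t] and [h2] on [s <= u < t]. Only the larger variable is compared with
   [t]; the bound on the smaller one follows. *)
pose h1 s u := f s * ltind s t * (g u * ltind u s%:E).
pose h2 s u := g u * ltind u t * (f s * leind s u).
have mh1 : measurable_fun setT (fun p : R * R => h1 p.1 p.2).
  apply: emeasurable_funM; first exact: (measurableT_comp mft).
  by apply: emeasurable_funM; [exact: measurableT_comp|exact: measurable_ltind].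
have mh2 : measurable_fun setT (fun p : R * R => h2 p.1 p.2).
  apply: emeasurable_funM; first exact: (measurableT_comp mgt).
  by apply: emeasurable_funM; [exact: measurableT_comp|exact: measurable_leind].
have h10 s u : 0 <= h1 s u by rewrite mule_ge0// mule_ge0// ltind_ge0.
have h20 s u : 0 <= h2 s u by rewrite mule_ge0// mule_ge0// leind_ge0.
transitivity (\int[mu]_s \int[mu]_u (h1 s u + h2 s u)).
  rewrite {1}/cum -ge0_integralZr//; last exact: cum_ge0.
  apply: eq_integral => s _; rewrite -ge0_integralZl//.
  apply: eq_integral => u _.
  rewrite /h1 /h2 /ltind /leind lte_fin.
  have [us|su] := ltP u s.
    rewrite mule0 mule0 adde0 mule1.
    have [st|] := boolP (s%:E < t); last by rewrite mule0 !mul0e.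
    by rewrite (lt_trans _ st) ?lte_fin// !mule1.
  rewrite mule0 mule0 add0e mule1.
  have [ut|] := boolP (u%:E < t); last by rewrite !mule0 mul0e.
  by rewrite (le_lt_trans _ ut) ?lee_fin// !mule1 muleC.
transitivity (\int[mu]_s (\int[mu]_u h1 s u + \int[mu]_u h2 s u)).
  apply: eq_integral => s _; rewrite ge0_integralD//.
    exact: (measurableT_comp mh1 (measurable_pair1 s)).
  exact: (measurableT_comp mh2 (measurable_pair1 s)).
rewrite ge0_integralD//; last 4 first.
- by move=> s _; exact: integral_ge0.
- exact: (measurable_fun_fubini_tonelli_F (m2 := mu) (fun p : R * R => h1 p.1 p.2)).
- by move=> s _; exact: integral_ge0.
- exact: (measurable_fun_fubini_tonelli_F (m2 := mu) (fun p : R * R => h2 p.1 p.2)).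
(* In [h2] the larger variable is the inner one, so the order of integration is exchanged there. *)
rewrite (tonelli mh2)//; congr (_ + _); apply: eq_integral => s _.
  rewrite ge0_integralZl//; first by rewrite muleAC.
  - by apply: emeasurable_funM => //; exact: measurable_ltindr.
  - by move=> u _; rewrite mule_ge0// ltind_ge0.
rewrite ge0_integralZl//; first by rewrite cum_leind// muleAC.
- by apply: emeasurable_funM => //; exact: measurable_leind.
- by move=> u _; rewrite mule_ge0// leind_ge0.
Qed.
End iterated_integrals.

(** * Iterated integrals of words and their shuffle product *)

Section word_integrals.
Variable R : realType.
Implicit Types (f g : R -> \bar R) (w : seq bool).
Local Notation mu := (@lebesgue_measure R).
Local Open Scope ereal_scope.

Definition letter_weight (a : bool) (u : R) : R :=
  ((0 < u)%R%:R * (if a then expR (- u) / u else 1))%R.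

Lemma letter_weight_ge0 a u : (0 <= letter_weight a u)%R.
Proof.
rewrite /letter_weight; case: ltP => u0; last by rewrite mul0r.
by rewrite mul1r; case: a => //; rewrite divr_ge0 ?expR_ge0 ?ltW.
Qed.

Lemma measurable_letter_weight a : measurable_fun setT (letter_weight a).
Proof.
apply: measurable_funM.
  by apply: measurable_fun_natr; exact: measurable_fun_ltr.
case: a => //; apply: measurable_funM; last exact: measurable_funV.
by apply: (measurableT_comp (@measurable_expR R)) => //; exact: measurable_funN.
Qed.

Fixpoint word_int w (t : \bar R) : \bar R :=
  if w is a :: w' then
    cum (fun u => (letter_weight a u)%:E * word_int w' u%:E) t
  else 1.

Lemma word_int_ge0 w t : 0 <= word_int w t.
Proof.
elim: w t => //= a w IH t; apply: cum_ge0 => u.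
by rewrite mule_ge0// lee_fin letter_weight_ge0.
Qed.

Lemma measurable_word_intM a w :
  measurable_fun setT (fun u => word_int w u%:E) ->
  measurable_fun setT (fun u => (letter_weight a u)%:E * word_int w u%:E).
Proof.
move=> mw; apply: emeasurable_funM => //.
by apply/measurable_EFinP; exact: measurable_letter_weight.
Qed.

Lemma measurable_word_int w : measurable_fun setT (fun u => word_int w u%:E).
Proof.
elim: w => [|a w IH]; first exact: measurable_cst.
apply: measurable_cum => [|u]; first exact: measurable_word_intM.
by rewrite mule_ge0 ?word_int_ge0// lee_fin letter_weight_ge0.
Qed.

(** A list of words with multiplicity, rather than an element of [Hxy], so that possibly infinite
    integrals can be summed over it. *)
Fixpoint shuffles (u : seq bool) : seq bool -> seq (seq bool) :=
  fix shuffles_u v :=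
  match u, v with
  | [::], _ => [:: v]
  | _, [::] => [:: u]
  | a :: u', b :: v' =>
      [seq a :: s | s <- shuffles u' v] ++ [seq b :: s | s <- shuffles_u v']
  end.

Lemma shuffles0s v : shuffles [::] v = [:: v]. Proof. by case: v. Qed.
Lemma shuffless0 u : shuffles u [::] = [:: u]. Proof. by case: u. Qed.
Lemma shuffles_cons a u b v : shuffles (a :: u) (b :: v) =
  [seq a :: s | s <- shuffles u (b :: v)] ++ [seq b :: s | s <- shuffles (a :: u) v].
Proof. by []. Qed.

Lemma word_int_cons_sum a (l : seq (seq bool)) t :
  \sum_(s <- l) word_int (a :: s) t =
  cum (fun u => (letter_weight a u)%:E * \sum_(s <- l) word_int s u%:E) t.
Proof.
rewrite /cum /= -ge0_integral_sum//.
- apply: eq_integral => u _; rewrite ge0_sume_distrr; last first.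
    by move=> *; exact: word_int_ge0.
  rewrite ge0_sume_distrl// => s _.
  by rewrite mule_ge0 ?word_int_ge0// lee_fin letter_weight_ge0.
- move=> s; apply: emeasurable_funM; last exact: measurable_ltindr.
  by apply: measurable_word_intM; exact: measurable_word_int.
- move=> s u _; rewrite mule_ge0 ?ltind_ge0//.
  by rewrite mule_ge0 ?word_int_ge0// lee_fin letter_weight_ge0.
Qed.

(** [cumM] distinguishes which of the two leading variables is larger, exactly as the shuffle
    recursion chooses the first letter. The integrals under the larger variable are multiplied by
    induction. *)
Lemma word_intM u v t :
  word_int u t * word_int v t = \sum_(s <- shuffles u v) word_int s t.
Proof.
elim: u v t => [|a u IHu] v t; first by rewrite shuffles0s big_seq1 mul1e.
elim: v t => [|b v IHv] t; first by rewrite shuffless0 big_seq1 mule1.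
rewrite shuffles_cons big_cat/= !big_map !word_int_cons_sum.
have cum_nneg c w s : 0 <= (letter_weight c s)%:E * word_int w s%:E.
  by rewrite mule_ge0 ?word_int_ge0// lee_fin letter_weight_ge0.
rewrite cumM//; try by apply: measurable_word_intM; exact: measurable_word_int.
congr (_ + _); apply: eq_integral => s _; congr (_ * _).
  by rewrite -[cum _ s%:E]/(word_int (b :: v) s%:E) -muleA IHu.
rewrite -[cum _ s%:E]/(word_int (a :: u) s%:E) -muleA; congr (_ * _).
by rewrite muleC IHv.
Qed.

(** * Exponential integrals and Laplace transforms of the iterated integrals *)

Lemma is_derive_expRM (c x : R) : c != 0%R ->
  is_derive x 1%R (fun t : R => - (expR (- c * t) / c))%R (expR (- c * x)).
Proof.
move=> c0.
rewrite (_ : (fun t : R => _) = - (c^-1) \*: (expR \o (fun t : R => - c * t)))%R.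
  apply: is_derive_eq; rewrite /GRing.scale/=.
  by rewrite mulr1 mulrN mulrNN mulrCA mulVf ?mulr1.
by apply/funext => t; rewrite [(_ / c)%R]mulrC -[LHS]mulNr.
Qed.

Lemma integral_expR (c a : R) : (0 < c)%R ->
  \int[mu]_(t in `[a, +oo[) (expR (- c * t))%:E = (expR (- c * a) / c)%:E.
Proof.
move=> c0.
have cf : continuous (fun t : R^o => expR (- c * t)).
  move=> z; apply: continuous_comp; last exact: continuous_expR.
  by apply: continuousM => //; apply: (@continuousN _ R^o); exact: cst_continuous.
rewrite (@ge0_continuous_FTC2y _ _ (fun t => - (expR (- c * t) / c))%R _ 0%R).
- by rewrite EFinN oppeK add0e.
- by move=> x _; exact: expR_ge0.
- by apply: continuous_subspaceT => x; exact: cf.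
- rewrite -oppr0 -(mul0r c^-1)%R; apply: cvgN; apply: cvgMr_tmp.
  rewrite (_ : (fun x => expR (- c * x)) =
               (fun z => expR (- z)) \o (fun z => c * z)%R); last first.
    by apply: eq_fun => x; rewrite mulNr.
  apply: (@cvg_comp _ _ _ _ _ _ (pinfty_nbhs R)); last exact: cvgr_expR.
  exact: gt0_cvgMry.
- by move=> x _; apply: ex_derive; exact: is_derive_expRM; rewrite gt_eqF.
- by apply: cvgN; apply: cvgMr_tmp; apply/cvg_at_right_filter; exact: cf.
- move=> x _; rewrite derive1E; apply: derive_val.
  by apply: is_derive_expRM; rewrite gt_eqF.
Qed.

Lemma integral_expR_leind (c a : R) : (0 < c)%R ->
  \int[mu]_t ((expR (- c * t))%:E * leind a t) = (expR (- c * a) / c)%:E.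
Proof.
move=> c0; rewrite -integral_expR// [RHS]integral_mkcond.
apply: eq_integral => t _; rewrite /leind patchE mem_setE in_itv/= andbT.
by case: ifP => _; rewrite ?mule1 ?mule0.
Qed.

Lemma integral_expR_ltind (c a : R) : (0 < c)%R ->
  \int[mu]_t ((expR (- c * t))%:E * ltind a t%:E) = (expR (- c * a) / c)%:E.
Proof.
move=> c0; rewrite -integral_expR// -integral_itv_obnd_cbnd.
  rewrite [RHS]integral_mkcond.
  apply: eq_integral => t _; rewrite /ltind patchE mem_setE in_itv/= andbT lte_fin.
  by case: ifP => _; rewrite ?mule1 ?mule0.
apply: (@measurable_funS _ _ _ _ setT) => //.
by apply/measurable_EFinP; apply: (measurableT_comp (@measurable_expR R)).
Qed.

Definition laplace w (s : R) :=
  \int[mu]_t ((expR (- s * t))%:E * ltind 0 t%:E * word_int w t%:E).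

Lemma measurable_expRM (s : R) : measurable_fun setT (fun t => (expR (- s * t))%:E).
Proof.
by apply/measurable_EFinP; apply: (measurableT_comp (@measurable_expR R)).
Qed.

Lemma measurable_laplace w : measurable_fun setT (fun s => laplace w s).
Proof.
apply: (measurable_fun_fubini_tonelli_F (m2 := mu) (fun p : R * R =>
  (expR (- p.1 * p.2))%:E * ltind 0 p.2%:E * word_int w p.2%:E)) => [|p].
  apply: emeasurable_funM; last exact: (measurableT_comp (measurable_word_int w)).
  apply: emeasurable_funM; last exact: measurable_ltind.
  apply/measurable_EFinP; apply: (measurableT_comp (@measurable_expR R)).
  by apply: measurable_funM => //; apply: measurable_funN.
by rewrite mule_ge0 ?word_int_ge0// mule_ge0 ?ltind_ge0// lee_fin expR_ge0.
Qed.

Lemma laplace_nil s : (0 < s)%R -> laplace [::] s = (s^-1)%:E.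
Proof.
move=> s0; rewrite /laplace; under eq_integral do rewrite mule1.
by rewrite integral_expR_ltind// mulr0 expR0 mul1r.
Qed.

(** After exchanging the integrals, the inner one is that of [exp(-s t)] over [t > u], which equals
    [exp(-s u)/s]. *)
Lemma laplace_cons a w s : (0 < s)%R -> laplace (a :: w) s = (s^-1)%:E *
  \int[mu]_u ((expR (- s * u))%:E * ((letter_weight a u)%:E * word_int w u%:E)).
Proof.
move=> s0.
pose f u := (letter_weight a u)%:E * word_int w u%:E.
have mf : measurable_fun setT f.
  by apply: measurable_word_intM; exact: measurable_word_int.
have f0 u : 0 <= f u.
  by rewrite mule_ge0 ?word_int_ge0// lee_fin letter_weight_ge0.
have me : measurable_fun setT (fun t => (expR (- s * t))%:E * ltind 0 t%:E).
  by apply: emeasurable_funM; [exact: measurable_expRM|exact: measurable_ltind].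
have e0 (t : R) : 0 <= (expR (- s * t))%:E * ltind 0 t%:E.
  by rewrite mule_ge0 ?ltind_ge0// lee_fin expR_ge0.
pose h (t u : R) := (expR (- s * t))%:E * ltind 0 t%:E * (f u * ltind u t%:E).
have mh : measurable_fun setT (fun p : R * R => h p.1 p.2).
  apply: emeasurable_funM; first exact: (measurableT_comp me).
  by apply: emeasurable_funM; [exact: measurableT_comp|exact: measurable_ltind].
transitivity (\int[mu]_t \int[mu]_u h t u).
  apply: eq_integral => t _; rewrite ge0_integralZl//.
    by apply: emeasurable_funM => //; exact: measurable_ltindr.
  by move=> u _; rewrite mule_ge0// ltind_ge0.
rewrite (tonelli mh); last first.
  by move=> t u; rewrite mule_ge0// mule_ge0// ltind_ge0.
rewrite -ge0_integralZl//; last 3 first.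
- by apply: emeasurable_funM => //; exact: measurable_expRM.
- by move=> u _; apply: mule_ge0; [rewrite lee_fin expR_ge0|exact: f0].
- by rewrite lee_fin invr_ge0 ltW.
apply: eq_integral => u _; rewrite -/(f u).
(* For [u <= 0] the weight of the letter vanishes; for [u > 0] the condition [0 < t] is implied by
   [u < t]. *)
have [u0|u0] := leP u 0%R.
  have fu0 : f u = 0 by rewrite /f /letter_weight ltNge u0 mul0r mul0e.
  rewrite fu0 2!mule0; apply: integral0_eq => t _.
  by rewrite /h fu0 mul0e mule0.
transitivity (\int[mu]_t (f u * ((expR (- s * t))%:E * ltind u t%:E))).
  apply: eq_integral => t _; rewrite /h muleCA; congr (_ * _).
  rewrite /ltind !lte_fin.
  have [ut|_] := ltP u t; last by rewrite !mule0.
  by rewrite (lt_trans u0 ut) !mule1.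
rewrite ge0_integralZl//; last 2 first.
- by apply: emeasurable_funM; [exact: measurable_expRM|exact: measurable_ltind].
- by move=> t _; rewrite mule_ge0 ?ltind_ge0// lee_fin expR_ge0.
by rewrite integral_expR_ltind// [(_ / s)%R]mulrC EFinM [LHS]muleC -muleA.
Qed.

Lemma laplace_x w s : (0 < s)%R ->
  laplace (false :: w) s = (s^-1)%:E * laplace w s.
Proof.
move=> s0; rewrite laplace_cons//; congr (_ * _); apply: eq_integral => u _.
by rewrite muleA; congr (_ * _ * _); rewrite /letter_weight mulr1 /ltind lte_fin.
Qed.

(** Expand [exp(-u)/u] as the integral of [exp(-u x)] over [x >= 1] and exchange. Without the
    prefactor [1/s] of [laplace_cons], the identity extends to [s = 0], where it gives the iterated
    integral up to [+oo]. *)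
Lemma integral_y w s : (0 <= s)%R ->
  \int[mu]_u ((expR (- s * u))%:E * ((letter_weight true u)%:E * word_int w u%:E)) =
  \int[mu]_x (leind 1 x * laplace w (s + x)).
Proof.
move=> s0.
pose h (x u : R) := leind 1 x *
  ((expR (- (s + x) * u))%:E * ltind 0 u%:E * word_int w u%:E).
have mh : measurable_fun setT (fun p : R * R => h p.1 p.2).
  apply: emeasurable_funM; first exact: measurable_leind.
  apply: emeasurable_funM; last exact: (measurableT_comp (measurable_word_int w)).
  apply: emeasurable_funM; last exact: measurable_ltind.
  apply/measurable_EFinP; apply: (measurableT_comp (@measurable_expR R)).
  apply: measurable_funM => //; apply: measurable_funN.
  exact: measurable_funD.
have h0 x u : 0 <= h x u.
  by rewrite mule_ge0 ?leind_ge0// mule_ge0 ?word_int_ge0// mule_ge0 ?ltind_ge0//.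
transitivity (\int[mu]_x \int[mu]_u h x u); last first.
  apply: eq_integral => x _; rewrite ge0_integralZl ?leind_ge0//.
    apply: emeasurable_funM; last exact: measurable_word_int.
    by apply: emeasurable_funM; [exact: measurable_expRM|exact: measurable_ltind].
  move=> u _; by rewrite mule_ge0 ?word_int_ge0// mule_ge0 ?ltind_ge0//.
rewrite (tonelli mh)//; apply: eq_integral => u _.
have [u0|u0] := leP u 0%R.
  rewrite /letter_weight ltNge u0 mul0r mul0e mule0; apply/esym/integral0_eq => x _.
  by rewrite /h /ltind lte_fin ltNge u0 mule0 mul0e mule0.
transitivity (\int[mu]_x ((expR (- s * u))%:E * word_int w u%:E *
    ((expR (- u * x))%:E * leind 1 x))).
  rewrite ge0_integralZl//; last 3 first.
  - by apply: emeasurable_funM; [exact: measurable_expRM|exact: measurable_leind].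
  - by move=> x _; rewrite mule_ge0 ?leind_ge0// lee_fin expR_ge0.
  - by rewrite mule_ge0 ?word_int_ge0// lee_fin expR_ge0.
  by rewrite integral_expR_leind// /letter_weight u0 mul1r mulr1 muleAC muleA.
apply: eq_integral => x _; rewrite /h /ltind lte_fin u0 mule1.
have -> : expR (- (s + x) * u) = (expR (- s * u) * expR (- u * x))%R.
  by rewrite -expRD !mulNr mulrDl opprD (mulrC x).
by rewrite EFinM [LHS]muleA [LHS]muleC; congr (_ * _); rewrite muleAC.
Qed.

End word_integrals.

(** * Shifted zeta integrals: identification with word integrals, and finiteness *)

Section zeta_integrals.
Variable R : realType.
Implicit Types (s x u : R) (ks : seq nat).
Local Notation mu := (@lebesgue_measure R).
Local Open Scope ereal_scope.

(** The parameter [s] carries the sum of the variables already fixed, so the partial sums in the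
    denominators become a recursion on [ks]; the zeta integral itself is the case [s = 0]. *)
Fixpoint zint ks s : \bar R :=
  if ks is k :: ks' then
    \int[mu]_x (leind 1 x * ((((s + x) ^+ k)^-1)%:E * zint ks' (s + x)))
  else 1.

Lemma eq_leind1 x (a b : \bar R) :
  ((1 <= x)%R -> a = b) -> leind 1 x * a = leind 1 x * b.
Proof.
by rewrite /leind; have [x1 ->|_ _] := leP 1%R x; rewrite ?mul0e.
Qed.

Lemma laplace_nseq k w s : (0 < s)%R ->
  laplace (nseq k false ++ w) s = ((s ^+ k)^-1)%:E * laplace w s.
Proof.
move=> s0; elim: k => [|k IH]; first by rewrite expr0 invr1 mul1e.
by rewrite /= laplace_x// IH muleA -EFinM exprS invfM.
Qed.

(** The [k - 1] letters [x] contribute the power [k - 1] of [1/(s + x)], and the Laplace transform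
    of the remaining word contributes one more factor. *)
Lemma integral_y_zseq k ks s : (0 < k)%N -> (0 <= s)%R ->
  (forall x, (0 < x)%R -> laplace (zseq ks) x = (x^-1)%:E * zint ks x) ->
  \int[mu]_x (leind 1 x * laplace (nseq k.-1 false ++ zseq ks) (s + x)) =
  zint (k :: ks) s.
Proof.
move=> k0 s0 lap; apply: eq_integral => x _; apply: eq_leind1 => x1.
have sx : (0 < s + x)%R by rewrite ltr_wpDl// (lt_le_trans _ x1).
by rewrite laplace_nseq// lap// muleA -EFinM -invfM -exprSr prednK.
Qed.

Lemma laplace_zseq ks s : all (leq 1) ks -> (0 < s)%R ->
  laplace (zseq ks) s = (s^-1)%:E * zint ks s.
Proof.
elim: ks s => [|k ks IH] s /=; first by rewrite mule1 => _; exact: laplace_nil.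
move=> /andP[k0 ks0] s0; rewrite [LHS]laplace_cons//; congr (_ * _).
rewrite integral_y ?ltW//; apply: integral_y_zseq; rewrite ?ltW// => x x0.
exact: IH.
Qed.

(** The formula of [laplace_zseq] is singular at [s = 0], so the first letter is treated by
    [integral_y] at [s = 0], and Laplace transforms are taken only of the rest, at arguments
    [x >= 1]. *)
Lemma word_int_zseq ks : (0 < size ks)%N -> all (leq 1) ks ->
  word_int (zseq ks) +oo = zint ks 0.
Proof.
case: ks => // k ks _ /andP[k0 ks0]; rewrite -integral_y_zseq//; last first.
  by move=> x x0; exact: laplace_zseq.
rewrite -integral_y//; apply: eq_integral => u _.
by rewrite /ltind ltry mule1 oppr0 mul0r expR0 mul1e.
Qed.

Lemma word_int_x u : (0 < u)%R -> word_int [:: false] u%:E = u%:E.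
Proof.
move=> u0; transitivity (\int[mu]_(v in `]0%R, u[) (1 : \bar R)).
  rewrite [RHS]integral_mkcond; apply: eq_integral => v _.
  rewrite patchE mem_setE in_itv/= /letter_weight /ltind lte_fin mulr1 mule1.
  by case: ltP => /= _; [rewrite mul1e; case: ltP|rewrite mul0e].
rewrite integral_cst// mul1e; apply: (etrans (lebesgue_measure_itv `]0%R, u[%R)).
by rewrite /= lte_fin u0 oppr0 adde0.
Qed.

(** The integrand is the Laplace transform of [u] at [s + x]. By [integral_y] the factor [u] cancels
    the denominator of [exp(-u)/u], leaving the integral of [exp(-(s+1)u)] over [u > 0]. *)
Lemma integral_invr_sqr s : (0 <= s)%R ->
  \int[mu]_x (leind 1 x * (((s + x) ^+ 2)^-1)%:E) = ((s + 1)^-1)%:E.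
Proof.
move=> s0.
have s1 : (0 < s + 1)%R by rewrite ltr_wpDl.
transitivity (\int[mu]_x (leind 1 x * laplace [:: false] (s + x))).
  apply: eq_integral => x _; apply: eq_leind1 => x1.
  have sx : (0 < s + x)%R by rewrite ltr_wpDl// (lt_le_trans _ x1).
  by rewrite laplace_x// laplace_nil// -EFinM -invfM.
rewrite -integral_y// -laplace_nil//; apply: eq_integral => u _.
rewrite /letter_weight /ltind lte_fin.
have [u0|] := ltP 0%R u; last by rewrite !(mul0r, mul0e, mule0).
rewrite word_int_x// !mule1 mul1r -!EFinM -mulrA mulVf ?mulr1 ?gt_eqF//.
by rewrite -expRD opprD mulrDl mulN1r.
Qed.

Lemma zint_ge0 ks s : (0 <= s)%R -> 0 <= zint ks s.
Proof.
elim: ks s => //= k ks IH s s0; apply: integral_ge0 => x _.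
rewrite /leind; have [x1|] := leP 1%R x; last by rewrite mul0e.
have sx : (0 <= s + x)%R by rewrite addr_ge0// (le_trans _ x1).
by rewrite mul1e mule_ge0 ?IH// lee_fin invr_ge0 exprn_ge0.
Qed.

Lemma admissible_cons k ks : ks != [::] ->
  admissible (k :: ks) = (0 < k)%N && admissible ks.
Proof. by case: ks => // l ks _; rewrite /admissible /= -andbA. Qed.

Lemma admissible_all ks : admissible ks -> all (leq 1) ks.
Proof. by case/and3P. Qed.

Lemma invr_exp_le x (m n : nat) : (1 <= x)%R -> (m <= n)%N ->
  ((x ^+ n)^-1 <= (x ^+ m)^-1)%R.
Proof.
move=> x1 mn; have x0 : (0 < x)%R by apply: lt_le_trans x1.
by rewrite lef_pV2 ?posrE ?exprn_gt0// ler_weXn2l.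
Qed.

(** The bound reproduces itself: with [k >= 1], the product of [(s+x)^(-k)] and [1/(s+x+1)] is at
    most [(s+x)^(-2)], whose integral over [x >= 1] is [1/(s+1)]. For the last index, [k >= 2] gives
    the same majorant directly. *)
Lemma zint_le ks s : admissible ks -> (0 <= s)%R -> zint ks s <= ((s + 1)^-1)%:E.
Proof.
elim: ks s => // k ks IH s adm s0.
have ks1 : all (leq 1) ks.
  by have := admissible_all adm => /= /andP[].
rewrite -integral_invr_sqr//=.
(* Comparing integrals requires a measurable integrand; on [x >= 1] the tail [zint] is replaced by a
   multiple of [laplace], which is known to be measurable. *)
have pt x : (1 <= x)%R -> (((s + x) ^+ k)^-1)%:E *
    ((s + x)%:E * laplace (zseq ks) (s + x)) = (((s + x) ^+ k)^-1)%:E * zint ks (s + x).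
  move=> x1; have sx : (0 < s + x)%R by rewrite ltr_wpDl// (lt_le_trans _ x1).
  by rewrite laplace_zseq// [_ * ((_^-1)%:E * _)]muleA -EFinM divff ?mul1e// gt_eqF.
rewrite (_ : \int[mu]_x _ = \int[mu]_x (leind 1 x *
    ((((s + x) ^+ k)^-1)%:E * ((s + x)%:E * laplace (zseq ks) (s + x))))); last first.
  by apply: eq_integral => x _; apply: eq_leind1 => x1; rewrite pt.
have msx : measurable_fun setT (fun x : R => s + x)%R by exact: measurable_funD.
apply: ge0_le_integral => //.
- move=> x _; rewrite /leind; have [x1|_] := leP 1%R x; last by rewrite mul0e.
  have sx : (0 <= s + x)%R by rewrite addr_ge0// (le_trans _ x1).
  by rewrite mul1e pt// mule_ge0 ?zint_ge0// lee_fin invr_ge0 exprn_ge0.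
- apply: emeasurable_funM; first exact: measurable_leind.
  apply: emeasurable_funM.
    by apply/measurable_EFinP/measurable_funV/measurable_funX.
  apply: emeasurable_funM; first exact/measurable_EFinP.
  exact: (measurableT_comp (measurable_laplace _)).
- apply: emeasurable_funM; first exact: measurable_leind.
  by apply/measurable_EFinP/measurable_funV/measurable_funX.
move=> x _; rewrite /leind; have [x1|_] := leP 1%R x; last by rewrite !mul0e.
rewrite !mul1e pt//.
have sx1 : (1 <= s + x)%R by rewrite ler_wpDl.
have sx : (0 < s + x)%R by exact: lt_le_trans sx1.
have [ks0|ks0] := eqVneq ks [::].
  move: adm; rewrite ks0 => /and3P[_ _ /= k2].
  by rewrite mule1 lee_fin invr_exp_le.
move: adm; rewrite admissible_cons// => /andP[k1 /IH {}IH].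
apply: (@le_trans _ _ ((((s + x) ^+ k)^-1)%:E * ((s + x + 1)^-1)%:E)).
  by apply: lee_wpmul2l; [rewrite lee_fin invr_ge0 exprn_ge0// ltW|apply/IH/ltW].
rewrite -EFinM lee_fin exprS invfM expr1 mulrC [leRHS]mulrC ler_pM//.
- by rewrite invr_ge0 ltW// ltr_wpDr.
- by rewrite invr_ge0 exprn_ge0// ltW.
- by rewrite lef_pV2 ?posrE ?lerDl// ltr_wpDr.
- by rewrite -[X in (_ <= X^-1)%R]expr1 invr_exp_le.
Qed.
End zeta_integrals.

(** * From integrals over tuples to iterated integrals *)

Section zeta_tuple.
Variable R : realType.
Local Notation mR := (measurableTypeR R).
Local Notation mu := (@lebesgue_measure R).
Local Open Scope ereal_scope.

Definition cube n : set (n.-tuple mR) := [set x | forall i, (1 <= (tnth x i : R))%R].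

(* The integrand of [zetaC], with all the partial sums shifted by [s]. *)
Definition zeta_integrand n (ks : seq nat) (s : R) (x : n.-tuple mR) : R :=
  ((\prod_(i < n)
     (s + \sum_(j < n | (j <= i)%N) (tnth x j : R)) ^+ nth 0%N ks i)^-1)%R.

Lemma measurable_cube n : measurable (@cube n).
Proof.
rewrite (_ : @cube n = \bigcap_(i in [set: 'I_n])
    (@tnth _ mR ^~ i) @^-1` [set` `[1%R, +oo[%R]); last first.
  apply/seteqP; split=> t /= H i; last by have := H i I; rewrite /= in_itv/= andbT.
  by move=> _; rewrite /= in_itv/= andbT; exact: H.
apply: fin_bigcap_measurable => [|i _]; first exact: finite_finset.
by rewrite -[X in measurable X]setTI; exact: measurable_tnth.
Qed.

Lemma measurable_zeta_integrand n ks s : measurable_fun setT (@zeta_integrand n ks s).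
Proof.
apply: measurable_funV; apply: measurable_prod => i _; apply: measurable_funX.
apply: measurable_funD => //.
rewrite (_ : (fun x => _) = fun x : n.-tuple mR =>
    \sum_(j < n) (if (j <= i)%N then (tnth x j : R) else 0))%R.
  by apply: measurable_sum => j; case: (j <= i)%N => //; exact: measurable_tnth.
by apply/funext => x; rewrite big_mkcond.
Qed.

Lemma zeta_integrand_cons n k ks s x (t : n.-tuple mR) :
  zeta_integrand (k :: ks) s (consT (x, t)) =
  (((s + x) ^+ k)^-1 * zeta_integrand ks (s + x) t)%R.
Proof.
rewrite /zeta_integrand big_ord_recl invfM; congr (_^-1 * _^-1)%R.
  congr (_ ^+ _)%R; rewrite (big_pred1 ord0)//.
  by move=> i /=; rewrite leqn0.
apply: eq_bigr => i _; congr (_ ^+ _)%R.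
rewrite big_mkcond big_ord_recl/= addrA; congr (_ + _)%R.
by rewrite [RHS]big_mkcond; apply: eq_bigr => j _; rewrite tnthS.
Qed.

Lemma cube_cons n x (t : n.-tuple mR) :
  cube (consT (x, t)) <-> (1 <= x)%R /\ cube t.
Proof.
split=> [H|[x1 H] i].
  by split=> [|i]; [exact: (H ord0)|have := H (lift ord0 i); rewrite tnthS].
by case: (unliftP ord0 i) => [j ->|->]; [rewrite tnthS; exact: H|].
Qed.

Lemma zeta_integrand_ge0 n ks s (t : n.-tuple mR) : (0 <= s)%R -> cube t ->
  (0 <= zeta_integrand ks s t)%R.
Proof.
move=> s0 tc; rewrite invr_ge0 prodr_ge0// => i _.
rewrite exprn_ge0// addr_ge0// sumr_ge0// => j _.
exact: le_trans (tc j).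
Qed.

(** Extension by zero to the whole space, where pushforward and Tonelli apply without domains. *)
Definition cube_integrand n (ks : seq nat) (s : R) : n.-tuple mR -> \bar R :=
  (EFin \o zeta_integrand ks s) \_ (@cube n).

Lemma measurable_cube_integrand n ks s :
  measurable_fun setT (@cube_integrand n ks s).
Proof.
apply/(measurable_restrictT _ _).1; first exact: measurable_cube.
apply: (@measurable_funS _ _ _ _ setT) => //.
by apply/measurable_EFinP; exact: measurable_zeta_integrand.
Qed.

Lemma cube_integrand_ge0 n ks s t : (0 <= s)%R -> 0 <= @cube_integrand n ks s t.
Proof.
move=> s0; rewrite /cube_integrand patchE; case: ifPn => //.
by rewrite inE lee_fin => /zeta_integrand_ge0; exact.
Qed.

Lemma cube_integrand_cons n k ks s x (t : n.-tuple mR) :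
  cube_integrand (k :: ks) s (consT (x, t)) =
  leind 1 x * ((((s + x) ^+ k)^-1)%:E * cube_integrand ks (s + x) t).
Proof.
rewrite /cube_integrand !patchE /leind.
have [x1|x1] := leP 1%R x; last first.
  by rewrite mul0e memNset// => /cube_cons[]; rewrite leNgt x1.
have [tc|tc] := pselect (cube t).
  rewrite !mem_set//; last exact/cube_cons.
  by rewrite /= zeta_integrand_cons mul1e EFinM.
by rewrite memNset; [rewrite memNset// !mule0|move=> /cube_cons[]].
Qed.

(** [lebesgue_tuple] is built as the image of a product measure under [consT], so Tonelli splits off
    the first coordinate, which is then absorbed into the shift. *)
Lemma integral_cube_integrand n ks s : size ks = n -> (0 <= s)%R ->
  \int[lebesgue_tuple R n]_x cube_integrand ks s x = zint ks s.
Proof.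
elim: n ks s => [|n IH] [|k ks] s //=.
  (* In dimension zero the measure is a point mass at the empty tuple, and the integrand is the
     inverse of an empty product. *)
  move=> _ s0; rewrite integral_dirac//; last exact: measurable_cube_integrand.
  rewrite diracE mem_set// mul1e /cube_integrand patchE mem_set; last by case.
  by rewrite /= /zeta_integrand big_ord0 invr1.
move=> [szks] s0.
pose f := cube_integrand (k :: ks) s \o @consT R n.
have mf : measurable_fun setT f.
  apply: measurableT_comp; last exact: measurable_consT.
  exact: measurable_cube_integrand.
have f0 p : 0 <= f p by exact: cube_integrand_ge0.
transitivity (\int[mu \x lebesgue_tuple R n]_p f p).
  apply: (etrans (@ge0_integral_pushforward _ _ _ _ R _ (@measurable_consT R n)
    (mu \x lebesgue_tuple R n) setT _ _ _ _)) => //.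
  - exact: measurable_cube_integrand.
  - by move=> t _; exact: cube_integrand_ge0.
rewrite (fubini_tonelli1 f mf f0).
apply: eq_integral => x _; rewrite /fubini_F.
under eq_integral do rewrite /f /= cube_integrand_cons.
rewrite /leind; have [x1|x1] := leP 1%R x; last first.
  by rewrite mul0e; apply: integral0_eq => t _; rewrite mul0e.
have sx : (0 <= s + x)%R by rewrite addr_ge0// (le_trans _ x1).
under eq_integral do rewrite mul1e.
rewrite mul1e -(IH ks (s + x)%R)// ge0_integralZl//.
- exact: measurable_cube_integrand.
- by move=> t _; exact: cube_integrand_ge0.
- by rewrite lee_fin invr_ge0 exprn_ge0.
Qed.

Lemma zetaCE ks : zetaC R ks = fine (zint ks 0).
Proof.
rewrite -(@integral_cube_integrand (size ks))// -integral_mkcond /zetaC /Rintegral.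
congr fine; apply: eq_integral => x _; rewrite /= /zeta_integrand.
by congr (_^-1)%:E; apply: eq_bigr => i _; rewrite add0r.
Qed.

End zeta_tuple.

(** * Admissible words as index lists, and shuffles as sums of words *)

Lemma word0_zseq s : word0 s ->
  s = [::] \/ exists2 ks, admissible ks & s = zseq ks.
Proof.
move=> /word0P[->|[t ->]]; [by left|right].
(* Generalized over [k], the number of letters [x] read since the last [y]: a further [x] increments
   it, and a [y] closes a block of index [k + 1]. *)
suff /(_ 0%N) : forall k, exists2 ks, admissible ks &
  true :: nseq k false ++ rcons t false = zseq ks by [].
elim: t => [|[] t IH] k.
(* The [k] pending letters and the final [x] make [k + 1] letters, one less than the index, which is
   therefore at least 2. *)
- exists [:: k.+2]; first by [].
  by rewrite /zseq/= cats0 -[_ :: nseq k _]/(nseq k.+1 false) -addn1 nseqD.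
- have [ks adm E] := IH 0%N; exists (k.+1 :: ks).
    by rewrite admissible_cons// /=; case: ks adm {E}.
  by rewrite /zseq/= -/(zseq ks) -E.
- have [ks adm E] := IH k.+1; exists ks => //.
  by rewrite -E -addn1 nseqD -catA.
Qed.

Lemma shuffle_wordE u v : shuffle_word u v = \sum_(s <- shuffles u v) word s.
Proof.
elim: u v => [|a u IHu] v; first by rewrite shuffle_word0 shuffles0s big_seq1.
elim: v => [|b v IHv]; first by rewrite shuffle_words0 shuffless0 big_seq1.
rewrite shuffle_word_cons shuffles_cons big_cat !big_map IHu IHv !mulr_sumr.
by congr (_ + _); apply: eq_bigr => s _; rewrite -word_cat.
Qed.

(** * The real-valued linear map given by word integrals, and its agreement with [Z] *)

Section word_value.
Variable R : realType.

(** A divergent integral, such as that of the single letter [y], gets the value [0]; finiteness is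
    established for the words satisfying [word0]. *)
Definition word_value (s : seq bool) : R := fine (word_int s +oo).

Lemma word_value_zseq ks : admissible ks -> word_value (zseq ks) = zetaC R ks.
Proof.
move=> adm; rewrite zetaCE /word_value word_int_zseq ?admissible_all//.
by case/and3P: adm.
Qed.

Lemma word_int_fin_num s : word0 s -> word_int s (+oo : \bar R)%E \is a fin_num.
Proof.
move=> /word0_zseq[->//|[ks adm ->]].
rewrite word_int_zseq ?admissible_all//; last by case/and3P: adm.
rewrite ge0_fin_numE ?zint_ge0//.
by rewrite (le_lt_trans (zint_le adm (lexx 0)))// ltry.
Qed.

Lemma word_valueM u v : word0 u -> word0 v ->
  word_value u * word_value v = \sum_(s <- shuffles u v) word_value s.
Proof.
move=> u0 v0; have fu := word_int_fin_num u0; have fv := word_int_fin_num v0.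
(* The sum equals a product of two finite numbers, so each shuffle has a finite integral, without
   examining the form of the shuffled words. *)
have /sum_fin_numP fs :
    (\sum_(s <- shuffles u v) word_int s (+oo : \bar R))%E \is a fin_num.
  by rewrite -word_intM fin_numM.
rewrite -fineM// word_intM big_seq -sum_fine; last by move=> s /fs->.
by rewrite [RHS]big_seq.
Qed.

(** Defined on all of [Hxy], so that linearity comes from [mmap]; it is multiplicative for the
    shuffle product only on [H0], where all integrals involved converge. *)
Definition word_lin (f : Hxy) : R :=
  mmap ratr (fun m : {fmonom bool} => word_value m) f.

Lemma word_linE f : word_lin f = \sum_(m <- msupp f) ratr f@_m * word_value m.
Proof. exact: mmapE. Qed.

Lemma word_linZ a f : word_lin (a *: f) = ratr a * word_lin f.
Proof.
rewrite [LHS](mmapEw (msuppZ_le _ _)) word_linE mulr_sumr.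
by apply: eq_bigr => k _ /=; rewrite mcoeffZ rmorphM /= -mulrA.
Qed.

Lemma word_lin_sum (I : Type) (l : seq I) (F : I -> Hxy) :
  word_lin (\sum_(i <- l) F i) = \sum_(i <- l) word_lin (F i).
Proof.
elim/big_rec2 : _ => [|i x y _ IH]; first exact: mmap0.
by rewrite -IH; exact: mmapD.
Qed.

Lemma word_lin_word s : word_lin (word s) = word_value s.
Proof.
by rewrite /word_lin mmapU -[RHS]mul1r; congr (_ * _); exact: rmorph1.
Qed.

Lemma word_lin_shuffle (f g : H0) :
  word_lin (shuffle f g) = word_lin f * word_lin g.
Proof.
case: f g => [f /in_H0_suppP Hf] [g /in_H0_suppP Hg] /=.
rewrite /shuffle word_lin_sum !word_linE big_distrlr/=.
rewrite big_seq [RHS]big_seq; apply: eq_bigr => u uf.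
rewrite word_lin_sum big_seq [RHS]big_seq; apply: eq_bigr => v vg.
rewrite word_linZ shuffle_wordE word_lin_sum.
under eq_bigr do rewrite word_lin_word.
by rewrite -word_valueM; [rewrite rmorphM mulrACA|exact: Hf|exact: Hg].
Qed.

(** In the expansion over the support, the empty word feeds the rational constant and every other
    word is some [zseq ks], giving a multiple of a zeta value. *)
Lemma spanZC_word_lin (f : H0) : spanZC (word_lin f).
Proof.
case: f => [f /in_H0_suppP Hf] /=; rewrite word_linE big_seq.
elim/big_rec : _ => [|m z mf [c [s [adm ->]]]].
  by exists 0, [::]; split => //; rewrite big_nil rmorph0 addr0.
have [m0|[ks ks_adm mE]] := word0_zseq (Hf m mf).
  exists (f@_m + c), s; split => //.
  by rewrite m0 /word_value/= mulr1 rmorphD addrA.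
exists c, ((f@_m, ks) :: s); split; first by rewrite /= ks_adm.
by rewrite big_cons/= mE word_value_zseq// addrCA.
Qed.

(** The words satisfying [word0] span [H0], and both maps take the same values on them. *)
Lemma linear_word_lin (Z : {linear H0 -> R | ratr \; *%R}) :
  Z oneH0 = 1 ->
  (forall ks (ks_adm : admissible ks), Z (zwordH0 ks_adm) = zetaC R ks) ->
  forall w, Z w = word_lin w.
Proof.
move=> Z1 Zz w.
(* The default [0] makes this total on words; it is never met, since every word in the support of
   [w] satisfies [word0]. *)
pose wordH0 (s : seq bool) : H0 := insubd 0 (word s).
have wordK s : word0 s -> H0val (wordH0 s) = word s.
  by move=> s0; apply: insubdK; exact: in_H0_word.
have Zword s : word0 s -> Z (wordH0 s) = word_value s.
  move=> s0; case: (word0_zseq s0) => [sE|[ks adm sE]].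
    rewrite (_ : wordH0 s = oneH0) ?Z1 ?sE//.
    by apply: val_inj; rewrite /= -sE wordK// sE word_nil.
  rewrite sE word_value_zseq// -(Zz ks adm) -sE; congr (Z _).
  by apply: val_inj; rewrite /= wordK// sE zwordE.
have Hw m : m \in msupp (H0val w) -> word0 m by apply/in_H0_suppP; case: w.
have wE : w = \sum_(m <- msupp (H0val w)) (H0val w)@_m *: wordH0 m.
  apply: val_inj; rewrite [LHS]monalgE raddf_sum/= big_seq [RHS]big_seq.
  apply: eq_bigr => m /Hw m0.
  rewrite -[RHS]/(_ *: H0val (wordH0 m)) wordK//; apply/malgP => n.
  by rewrite mcoeffZ !mcoeffU mulr_natr; case: m {m0}.
rewrite {1}wE linear_sum word_linE big_seq [RHS]big_seq.
by apply: eq_bigr => m /Hw m0; rewrite linearZ/= Zword.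
Qed.
End word_value.

Theorem theorem1p2 (R : realType) (Z : {linear H0 -> R | ratr \; *%R})
    (Z_one : Z oneH0 = 1)
    (Z_word : forall (ks : seq nat) (ks_adm : admissible ks),
       Z (zwordH0 ks_adm) = zetaC R ks) :
  (forall w : H0, spanZC (Z w)) /\
  (forall w1 w2 : H0, Z (shuffleH0 w1 w2) = Z w1 * Z w2).
Proof.
have ZE := linear_word_lin Z_one Z_word.
split=> [w|w1 w2]; rewrite !ZE; first exact: spanZC_word_lin.
exact: word_lin_shuffle.
Qed.
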